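(* Let $m\geq 1$ be an integer and let $n=2m$. Let $A$ be the adjacency matrix of the $n$-cube graph $Q_n$ (with respect to any ordering of the vertices). Then $A$ is integrally equivalent to a $2^n\times 2^n$ diagonal matrix with exactly $\binom{n}{m}$ diagonal entries equal to zero, whose nonzero diagonal entries are the integers $k=1,2,\ldots,m$, in which the multiplicity of $k$ is $2\binom{n}{m-k}$.
   Context: The $n$-cube graph $Q_n$ has vertex set $\{0,1\}^n$, with two vertices joined by an edge if and only if the $n$-tuples differ in exactly one component. Two integral matrices $X$ and $Y$ of the same size are integrally equivalent if there exist unimodular integral matrices $U$ and $V$ (i.e. invertible over $\mathbb{Z}$) such that $UXV=Y$. *)

(* Defs.v *)
From mathcomp Require Import all_boot all_order all_algebra.

Set Implicit Arguments.
Unset Strict Implicit.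
Unset Printing Implicit Defensive.

Import GRing.Theory.

Local Open Scope ring_scope.

Definition cube_vertex (n : nat) : finType := {ffun 'I_n -> bool}.

Definition cube_adj (n : nat) : rel (cube_vertex n) :=
  fun x y => #|[set i : 'I_n | x i != y i]| == 1%N.

(* [v] is the ordering of the vertices: it lists the vertex of each index and
   is meant to be bijective. *)
Definition adjacency_mx (T : finType) (e : rel T) (N : nat) (v : 'I_N -> T) :
    'M[int]_N :=
  \matrix_(i, j) (e (v i) (v j))%:R.

Definition integrally_equivalent (p q : nat) (X Y : 'M[int]_(p, q)) : Prop :=
  exists (U : 'M[int]_p) (V : 'M[int]_q),
    [/\ U \in unitmx, V \in unitmx & U *m X *m V = Y].

(* Main.v *)
Require Import Defs.
From mathcomp Require Import all_boot all_order all_algebra.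
From mathcomp Require Import zify ring.

Set Implicit Arguments.
Unset Strict Implicit.
Unset Printing Implicit Defensive.

Import GRing.Theory.

Local Open Scope ring_scope.

(* In the basis of the zeta functions z |-> [S <= z], the adjacency operator A
   becomes (n - 2|S|) on the diagonal plus the covering relation W of the
   Boolean lattice.  As n = 2m, the diagonal vanishes on level m, so the
   operator is the direct sum of its restriction A1 to the rows of levels < m
   (with columns of levels <= m) and of a part A2 that complementation turns
   into the transpose of A1.

   Let S be the bottom of a symmetric (Greene-Kleitman) chain and v_k(S) the sum
   of the k-sets containing S.  The v_k(S), with (S, k) running over the elements
   of the chains, form a Z-basis, and so do the two triangular families
     h_k(S) = sum_l C(m-1-l, k-l) 2^(k-l) v_l(S)   (k < m),
     g_k(S) = sum_l C(m-l, k-l) 2^(k-l) v_l(S)     (k <= m).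
   A binomial identity gives h_k(S) A1 = (k+1-|S|) g_(k+1)(S), a diagonal form
   of A1 up to a permutation; the multiplicity of an integer is the number of
   chains that start low enough. *)

(** * Integral row spans of families of functions *)

Section Span.

Variables X Y : finType.
Implicit Types (F : X -> Y -> int) (f g : Y -> int).

Definition in_span F f := exists c : X -> int, forall y, \sum_x c x * F x y = f y.

Lemma in_span_row F x : in_span F (F x).
Proof.
exists (fun x' => (x' == x)%:R) => y.
rewrite (bigD1 x) //= eqxx mul1r big1 ?addr0 // => x' /negPf ->.
by rewrite mul0r.
Qed.

Lemma in_spanD F f g : in_span F f -> in_span F g -> in_span F (fun y => f y + g y).
Proof.
move=> [c Hc] [d Hd]; exists (fun x => c x + d x) => y.
by rewrite -Hc -Hd -big_split; apply: eq_bigr => x _; rewrite mulrDl.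
Qed.

Lemma in_spanN F f : in_span F f -> in_span F (fun y => - f y).
Proof.
move=> [c Hc]; exists (fun x => - c x) => y.
by rewrite -Hc -sumrN; apply: eq_bigr => x _; rewrite mulNr.
Qed.

Lemma eq_in_span F f g : f =1 g -> in_span F f -> in_span F g.
Proof. by move=> E [c Hc]; exists c => y; rewrite Hc. Qed.

End Span.

Lemma in_span_trans (X X' Y : finType) (F : X -> Y -> int) (G : X' -> Y -> int)
    (f : Y -> int) :
  (forall x, in_span F (G x)) -> in_span G f -> in_span F f.
Proof.
move=> HG [c Hc]; have [D HD] := fin_all_exists HG.
exists (fun x => \sum_x' c x' * D x' x) => y.
rewrite -Hc; under eq_bigr do rewrite mulr_suml.
rewrite exchange_big; apply: eq_bigr => x' _.
by rewrite -HD mulr_sumr; apply: eq_bigr => x _; rewrite mulrA.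
Qed.

Lemma in_span_delta (Y : finType) (f : Y -> int) :
  in_span (fun x y => (x == y)%:R) f.
Proof.
exists f => y; rewrite (bigD1 y) //= eqxx mulr1 big1 ?addr0 // => x /negPf ->.
by rewrite mulr0.
Qed.

(** * Square matrices indexed by a finite type *)

Section IndexedMatrix.

Variables (X : finType) (N : nat) (u : 'I_N -> X).
Hypothesis u_bij : bijective u.
Implicit Types F G : X -> X -> int.

Definition fun_mx F : 'M[int]_N := \matrix_(i, j) F (u i) (u j).

Lemma eq_fun_mx F G : F =2 G -> fun_mx F = fun_mx G.
Proof. by move=> E; apply/matrixP => i j; rewrite !mxE E. Qed.

Lemma fun_mxM F G :
  fun_mx F *m fun_mx G = fun_mx (fun x z => \sum_y F x y * G y z).
Proof.
apply/matrixP => i j; rewrite !mxE.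
rewrite (reindex u) /=; last exact: onW_bij.
by apply: eq_bigr => k _; rewrite !mxE.
Qed.

Lemma fun_mx_tr F : (fun_mx F)^T = fun_mx (fun x y => F y x).
Proof. by apply/matrixP => i j; rewrite !mxE. Qed.

Lemma fun_mx1 : fun_mx (fun x y => (x == y)%:R) = 1%:M.
Proof.
by apply/matrixP => i j; rewrite !mxE (inj_eq (bij_inj u_bij)).
Qed.

(** The coefficients that express the delta functions form a left inverse, which for a square matrix
    over a commutative ring is two-sided. *)
Lemma fun_mx_unit F :
  (forall y, in_span F (fun z => (y == z)%:R)) -> fun_mx F \in unitmx.
Proof.
move=> /fin_all_exists[C HC].
suff /mulmx1_unit[] : fun_mx C *m fun_mx F = 1%:M by [].
by rewrite fun_mxM -fun_mx1; apply: eq_fun_mx => x z; rewrite HC.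
Qed.

End IndexedMatrix.

(** * The Boolean cube and its symmetric chains *)

(** Nested pairs let orders, chains and sums recurse on the first coordinate. *)
Fixpoint bcube (n : nat) : finType :=
  if n is n'.+1 then (bool * bcube n')%type else unit.

Lemma bcube_sum n (F : bcube n.+1 -> int) :
  \sum_x F x = \sum_x F (false, x) + \sum_x F (true, x).
Proof.
transitivity (\sum_(p : bool * bcube n) F (p.1, p.2)); first by apply: eq_bigr => -[].
by rewrite -(pair_bigA _ (fun b x => F (b, x))) /= big_bool addrC.
Qed.

Fixpoint wt n : bcube n -> nat :=
  if n is n'.+1 then fun x : bcube n'.+1 => (x.1 + wt x.2)%N else fun=> 0%N.

Fixpoint sub n : rel (bcube n) :=
  if n is n'.+1 then fun x y : bcube n'.+1 => (x.1 ==> y.1) && sub x.2 y.2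
  else fun _ _ => true.

Fixpoint adj n : rel (bcube n) :=
  if n is n'.+1 then fun x y : bcube n'.+1 =>
    if x.1 == y.1 then adj x.2 y.2 else x.2 == y.2
  else fun _ _ => false.

Fixpoint covers n : rel (bcube n) :=
  if n is n'.+1 then fun x y : bcube n'.+1 =>
    if x.1 == y.1 then covers x.2 y.2 else y.1 && (x.2 == y.2)
  else fun _ _ => false.

Fixpoint compl n : bcube n -> bcube n :=
  if n is n'.+1 then fun x : bcube n'.+1 => (~~ x.1, compl x.2) else id.

(* Reading the word from its end, every 1 is matched with a previously read and
   still unmatched 0, if there is one; [bot x] keeps the matched 1s.  The words
   with the same [bot] form a symmetric chain (Greene-Kleitman), and the strict
   inequality says that an unmatched 0 is left, i.e. that [x.2] is not the top
   of its chain. *)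
Fixpoint bot n : bcube n -> bcube n :=
  if n is n'.+1 then fun x : bcube n'.+1 =>
    (x.1 && (wt x.2 + wt (bot x.2) < n')%N, bot x.2)
  else id.

(* The element of weight [k] in the chain with bottom [s]; a junk value unless
   [s] is a bottom and [wt s <= k <= n - wt s]. *)
Fixpoint chain n : bcube n -> nat -> bcube n :=
  if n is n'.+1 then fun (s : bcube n'.+1) k =>
    if ~~ s.1 && (k + wt s.2 <= n')%N then (false, chain s.2 k)
    else (true, chain s.2 k.-1)
  else fun s _ => s.

Lemma wt_le n (x : bcube n) : (wt x <= n)%N.
Proof. by elim: n x => [|n IH] //= [b x] /=; have := IH x; case: b; lia. Qed.

Lemma wt_bot n (x : bcube n) :
  (wt (bot x) <= wt x)%N /\ (wt x + wt (bot x) <= n)%N.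
Proof.
elim: n x => [|n IH] //= [b x] /=.
by have [H1 H2] := IH x; case: b => /=; case: ltnP => ? /=; lia.
Qed.

Lemma wt_sub n (x y : bcube n) : sub x y -> (wt x <= wt y)%N.
Proof.
elim: n x y => [|n IH] //= [b x] [c y] /= /andP[bc /IH].
by case: b c bc => [] [] //=; lia.
Qed.

Lemma chain_bot n (x : bcube n) : chain (bot x) (wt x) = x.
Proof.
elim: n x => [|n IH] //= [b x] /=.
have [H1 H2] := wt_bot x.
case: b => /=; last by rewrite ifT ?IH // add0n.
by case: ltnP => _ /=; rewrite IH.
Qed.

Lemma wt_chain n (x : bcube n) k :
  (wt (bot x) <= k)%N -> (k + wt (bot x) <= n)%N ->
  wt (chain (bot x) k) = k /\ bot (chain (bot x) k) = bot x.
Proof.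
elim: n x k => [|n IH] => [x k _ /=|[b x] k /=]; first by rewrite addn0 leqn0 => /eqP.
have [H1 H2] := wt_bot x.
case: (boolP (b && _)) => [/andP[_ Hb]|Hb] /= Hk1 Hk2.
  have [] := IH x k.-1; [lia|lia|].
  move=> E1 E2; rewrite /= E1 E2; split; first lia.
  by congr pair; lia.
case: (leqP (k + wt (bot x)) n) => Hk3 /=.
  by have [|//|-> ->] := IH x k; first lia.
(* Here [k] is the new top level: a 1 is prefixed to the old top, which has no unmatched 0 left. *)
have [] := IH x k.-1; [lia|lia|].
move=> -> ->; split; first lia.
by congr pair; apply/negbTE; lia.
Qed.

Lemma bot_wt_inj n (x y : bcube n) : bot x = bot y -> wt x = wt y -> x = y.
Proof. by move=> E1 E2; rewrite -(chain_bot x) -(chain_bot y) E1 E2. Qed.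

Lemma complK n : involutive (@compl n).
Proof. by elim: n => [|n IH] //= [b x]; rewrite /= negbK IH. Qed.

Lemma wt_compl n (x : bcube n) : wt (compl x) = (n - wt x)%N.
Proof.
elim: n x => [|n IH] //= [b x] /=; rewrite IH.
by have := wt_le x; case: b => /=; lia.
Qed.

Lemma covers_wt n (x y : bcube n) : covers x y -> wt y = (wt x).+1.
Proof.
elim: n x y => [|n IH] //= [b x] [c y] /=.
by case: b c => [] [] //= => [/IH|/eqP->|/IH]; lia.
Qed.

Lemma covers_compl n (x y : bcube n) : covers (compl x) (compl y) = covers y x.
Proof.
elim: n x y => [|n IH] //= [b x] [c y] /=; rewrite IH.
by rewrite (inj_eq (can_inj (@complK n))) (eq_sym x y); case: b c => [] [].
Qed.

(** * The adjacency operator on zeta functions *)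

Lemma sum_mul_delta (X : finType) (F : X -> int) y :
  \sum_x F x * (x == y)%:R = F y.
Proof.
rewrite (bigD1 y) //= eqxx mulr1 big1 ?addr0 // => x /negPf ->.
by rewrite mulr0.
Qed.

Lemma sum_delta_mul (X : finType) (F : X -> int) y :
  \sum_x (y == x)%:R * F x = F y.
Proof.
by rewrite -[RHS](sum_mul_delta F); apply: eq_bigr => x _; rewrite mulrC eq_sym.
Qed.

(** If [s] lies in [y], the [x] counted arise from [y] by deleting one element outside [s];
    otherwise both sides vanish. *)
Lemma sum_sub_covers n (s y : bcube n) :
  \sum_x (sub s x)%:R * (covers x y)%:R =
    ((wt y)%:R - (wt s)%:R) * (sub s y)%:R :> int.
Proof.
elim: n s y => [|n IH] s y.
  by rewrite big1 ?subrr ?mul0r // => x _; rewrite mulr0.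
case: s y => [a s] [c y]; rewrite bcube_sum.
have E0 : \sum_(x : bcube n) 0 * (covers x y)%:R = 0 :> int.
  by apply: big1 => x _; rewrite mul0r.
have E1 : \sum_(x : bcube n) (sub s x)%:R * 0 = 0 :> int.
  by apply: big1 => x _; rewrite mulr0.
have E2 : \sum_(x : bcube n) 0 * (x == y)%:R = 0 :> int.
  by apply: big1 => x _; rewrite mul0r.
have E3 : \sum_(x : bcube n) 0 * 0 = 0 :> int by apply: big1 => x _; rewrite mul0r.
case: a c => [] [] /=; rewrite ?IH ?sum_mul_delta ?E0 ?E1 ?E2 ?E3; ring.
Qed.

(** If [s] lies in [z], the [n - |s|] flips outside [s] count, and the sum on the right is [|s|]. If
    exactly one element of [s] is missing from [z], both sides are 1; otherwise they are 0. *)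
Lemma sum_adj_sub n (z s : bcube n) :
  \sum_x (adj z x)%:R * (sub s x)%:R =
    (n%:R - 2 * (wt s)%:R) * (sub s z)%:R
      + \sum_x (sub x z)%:R * (covers x s)%:R :> int.
Proof.
elim: n z s => [|n IH] z s.
  by rewrite !big1 ?subrr ?mul0r ?addr0 // => x _; rewrite ?mulr0 ?mul0r.
case: z s => [b z] [c s]; rewrite !bcube_sum.
have E0 : \sum_(x : bcube n) (adj z x)%:R * 0 = 0 :> int.
  by apply: big1 => x _; rewrite mulr0.
have E1 : \sum_(x : bcube n) (z == x)%:R * 0 = 0 :> int.
  by apply: big1 => x _; rewrite mulr0.
have E2 : \sum_(x : bcube n) 0 * (covers x s)%:R = 0 :> int.
  by apply: big1 => x _; rewrite mul0r.
have E3 : \sum_(x : bcube n) (sub x z)%:R * 0 = 0 :> int.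
  by apply: big1 => x _; rewrite mulr0.
have E4 : \sum_(x : bcube n) 0 * 0 = 0 :> int by apply: big1 => x _; rewrite mul0r.
case: b c => [] [] /=;
  rewrite ?IH ?sum_mul_delta ?sum_delta_mul ?E0 ?E1 ?E2 ?E3 ?E4 -?natr1; ring.
Qed.

(** * Integral bases adapted to the chains *)

(** This is v_k(S) for S = [bot x] and k = [wt x]; indexing by [x] makes the family square. *)
Definition level_row n (x y : bcube n) : int :=
  (sub (bot x) y && (wt x == wt y))%:R.

Definition extend n (b : bool) (f : bcube n -> int) (z : bcube n.+1) : int :=
  if z.1 == b then f z.2 else 0.

Lemma extendE n (f : bcube n.+1 -> int) z :
  f z = extend false (fun y => f (false, y)) z + extend true (fun y => f (true, y)) z.
Proof. by case: z => [[] z]; rewrite /extend /= ?add0r ?addr0. Qed.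

Lemma in_span_extend n (X : finType) (F : X -> bcube n -> int) b f :
  in_span F f -> in_span (fun x => extend b (F x)) (extend b f).
Proof.
move=> [c Hc]; exists c => -[a y]; rewrite /extend /=.
by case: eqP => _ //; rewrite big1 // => x _; rewrite mulr0.
Qed.

(* In coordinates (last word 0, last word 1), the chain of [x] produces in
   dimension n+1 the rows (v_k, v_(k-1)), (v_(top+1), v_top) and, for k < top,
   (0, v_k).  They generate first all (v_k, 0), hence all (f, 0) by induction,
   in particular (v_(top+1), 0), and therefore also (0, v_top). *)
Lemma level_row_span n (f : bcube n -> int) : in_span (@level_row n) f.
Proof.
elim: n f => [|n IH] f.
  exists f => y; rewrite (bigD1 y) //= big1 => [|x /negPf xy]; last first.
    by case: x y xy => [] [].
  by rewrite /level_row eqxx /= mulr1 addr0.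
have below_top x : (wt x + wt (bot x) < n)%N ->
    in_span (@level_row n.+1) (extend true (level_row x)).
  move=> H; apply: eq_in_span (in_span_row _ ((true, x) : bcube n.+1)).
  by case=> [[] z]; rewrite /level_row /extend /= H.
have first_row x : in_span (@level_row n.+1) (extend false (level_row x)).
  have [lo hi] := wt_bot x.
  have Hx := in_span_row (@level_row n.+1) ((false, x) : bcube n.+1).
  have [E|lt] := eqVneq (wt (bot x)) (wt x).
    apply: eq_in_span Hx => -[[] z]; rewrite /level_row /extend //=.
    by case: (boolP (sub _ _)) => //= /wt_sub; rewrite E; lia.
  have [wE bE] : wt (chain (bot x) (wt x).-1) = (wt x).-1 /\
      bot (chain (bot x) (wt x).-1) = bot x by apply: wt_chain; lia.
  set y := chain _ _ in wE bE.
  have Hy : in_span (@level_row n.+1) (extend true (level_row y)).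
    by apply: below_top; rewrite wE bE; lia.
  apply: eq_in_span (in_spanD Hx (in_spanN Hy)).
  case=> [[] z]; rewrite /level_row /extend /= ?bE ?wE ?oppr0 ?addr0 //.
  by rewrite (_ : (wt x == _)%N = ((wt x).-1 == wt z)) ?subrr //; lia.
have first g : in_span (@level_row n.+1) (extend false g).
  exact: in_span_trans first_row (in_span_extend false (IH g)).
have second g : in_span (@level_row n.+1) (extend true g).
  apply: in_span_trans (in_span_extend true (IH g)) => x.
  have [lo hi] := wt_bot x.
  have [/below_top//|top] := ltnP (wt x + wt (bot x)) n.
  have Hx := in_span_row (@level_row n.+1) ((true, x) : bcube n.+1).
  pose g0 z := level_row ((true, x) : bcube n.+1) ((false, z) : bcube n.+1).
  apply: eq_in_span (in_spanD Hx (in_spanN (first g0))).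
  case=> [[] z]; rewrite /extend /g0 /= ?oppr0 ?addr0 ?subrr //.
  by rewrite /level_row /= ltnNge top.
apply: eq_in_span (in_spanD (first (fun y => f (false, y)))
  (second (fun y => f (true, y)))) => z.
exact/esym/extendE.
Qed.

(** * The triangular families h and g *)

(** Coefficient of v_l(S) in h_k(S) for [d = m - 1], in g_k(S) for [d = m]. Without the test,
    truncated subtraction would give 1 for [k < l]. *)
Definition row_coef d k l : int :=
  if (l <= k)%N then ('C(d - l, k - l) * 2 ^ (k - l))%:R else 0.

Lemma row_coef_diag d k : row_coef d k k = 1.
Proof. by rewrite /row_coef leqnn subnn bin0 expn0. Qed.

Lemma row_coef_lt d k l : (k < l)%N -> row_coef d k l = 0.
Proof. by move=> lt; rewrite /row_coef leqNgt lt. Qed.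

Lemma row_coef_le d k l :
  (l <= k)%N -> row_coef d k l = 'C(d - l, k - l)%:R * 2 ^+ (k - l).
Proof. by move=> le; rewrite /row_coef le natrM natrX. Qed.

(** Compares, for i = |S|, the coefficients of v_l(S) in h_k(S) A1 and in (k+1-i) g_(k+1)(S). On the
    left, the first term comes from the diagonal, the second from the covers of level l-1. *)
Lemma row_coef_rec m k i l : (k < m)%N -> (i <= l)%N ->
  (2 * m%:R - 2 * l%:R) * row_coef m.-1 k l
    + (l%:R - i%:R) * row_coef m.-1 k l.-1
  = (k.+1%:R - i%:R) * row_coef m k.+1 l.
Proof.
move=> lt_km le_il.
have [lt_kl|le_lk] := ltnP k l.
  rewrite row_coef_lt // mulr0 add0r.
  have [->|neq] := eqVneq l k.+1; first by rewrite /= !row_coef_diag.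
  by rewrite !row_coef_lt ?mulr0 //; lia.
have bin_diag : (m%:R - l%:R) * 'C(m.-1 - l, k - l)%:R
    = (k.+1%:R - l%:R) * 'C(m - l, k.+1 - l)%:R :> int.
  rewrite -!natrB ?leqW //; last by lia.
  rewrite -!natrM subSn // -mul_bin_diag; congr ((_ * 'C(_, _))%:R); lia.
(* The differences stay the same when m, k+1 and l all drop by one; for l = 0 the factor l - i is
   0. *)
have E : (l%:R - i%:R) * row_coef m.-1 k l.-1
    = (l%:R - i%:R) * row_coef m k.+1 l.
  case: l le_il le_lk {bin_diag} => [|l] le_il le_lk.
    by rewrite (_ : i = 0%N) ?subrr ?mul0r //; lia.
  rewrite /= (row_coef_le _ (ltnW le_lk)) (row_coef_le _ (leqW le_lk)).
  by congr (_ * ('C(_, _)%:R * _ ^+ _)); lia.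
rewrite E !row_coef_le ?leqW // subSn // exprS -subSn //.
transitivity (2 * ((m%:R - l%:R) * 'C(m.-1 - l, k - l)%:R) * 2 ^+ (k - l)
  + (l%:R - i%:R) * ('C(m - l, k.+1 - l)%:R * (2 * 2 ^+ (k - l))) : int).
  by ring.
by rewrite bin_diag; ring.
Qed.

(** Above level [d], standard rows complete the family to a square matrix that leaves the other half
    of the operator alone. *)
Definition basis_row d n (x y : bcube n) : int :=
  if (wt x <= d)%N then (sub (bot x) y)%:R * row_coef d (wt x) (wt y)
  else (x == y)%:R.

Lemma basis_row_span d n (f : bcube n -> int) : in_span (@basis_row d n) f.
Proof.
suff Hy (y : bcube n) : in_span (@basis_row d n) (fun z => (y == z)%:R).
  exact: in_span_trans Hy (in_span_delta f).
have [k] := ubnP (wt y); elim: k y => // k IH y /ltnSE le_yk.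
have [le_yd|lt_dy] := leqP (wt y) d; last first.
  apply: eq_in_span (in_span_row (@basis_row d n) y) => z.
  by rewrite /basis_row leqNgt lt_dy.
have [c Hc] := level_row_span (fun z => (y == z)%:R).
(* Level rows of other levels vanish on the level of [y], so these coefficients still give the delta
   function there. By triangularity [g] differs from it only on lower levels, which the induction
   covers. *)
pose c' x := if wt x == wt y then c x else 0.
pose g z := \sum_x c' x * basis_row d x z.
have Hg : in_span (@basis_row d n) g by exists c'.
have gE z : (wt y <= wt z)%N -> g z = (y == z)%:R.
  move=> le_yz; rewrite -Hc /g.
  have [E|neq] := eqVneq (wt y) (wt z).
    apply: eq_bigr => x _; rewrite /c' /basis_row /level_row.
    case: eqVneq => [xy|xy]; last by rewrite -E (negPf xy) andbF mul0r mulr0.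
    by rewrite xy le_yd E eqxx row_coef_diag andbT mulr1.
  rewrite Hc (_ : y == z = false); last by apply/eqP => yz; rewrite yz eqxx in neq.
  apply: big1 => x _; rewrite /c' /basis_row.
  case: eqVneq => [xy|xy]; last by rewrite mul0r.
  have lt : (wt y < wt z)%N by rewrite ltn_neqAle neq.
  by rewrite xy le_yd row_coef_lt ?mulr0.
have Hlow : in_span (@basis_row d n)
    (fun z => if (wt z < wt y)%N then - g z else 0).
  pose G (x z : bcube n) : int := if (wt x < wt y)%N then (x == z)%:R else 0.
  apply: (@in_span_trans _ _ _ _ G) => [x|]; rewrite /G.
    have [lt|_] := ltnP (wt x) (wt y).
      by apply: IH; apply: leq_trans lt le_yk.
    by exists (fun=> 0) => z; rewrite big1 // => t _; rewrite mul0r.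
  exists (fun x => - g x) => z; rewrite (bigD1 z) //= big1 => [|x /negPf ->].
    by rewrite eqxx addr0; case: ifP => _; rewrite ?mulr1 ?mulr0.
  by case: ifP; rewrite mulr0.
apply: eq_in_span (in_spanD Hg Hlow) => z /=.
have [lt|ge] := ltnP (wt z) (wt y); last by rewrite addr0 gE.
by rewrite subrr; case: eqP lt => // ->; rewrite ltnn.
Qed.

(** Unimodularity of the zeta matrix: if F is the row of [x], then [(false, x)] and [(true, x)] have
    the rows (F, 0) and (F, F). *)
Lemma sub_row_span n (f : bcube n -> int) :
  in_span (fun x y : bcube n => (sub y x)%:R) f.
Proof.
elim: n f => [|n IH] f.
  exists f => y; rewrite (bigD1 y) //= big1 => [|x /negPf xy]; last first.
    by case: x y xy => [] [].
  by rewrite /= mulr1 addr0.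
pose F n := fun x y : bcube n => (sub y x)%:R : int.
have first_row x : in_span (F n.+1) (extend false (F n x)).
  apply: eq_in_span (in_span_row (F n.+1) ((false, x) : bcube n.+1)).
  by case=> [[] z].
have second_row x : in_span (F n.+1) (extend true (F n x)).
  have Hx := in_span_row (F n.+1) ((true, x) : bcube n.+1).
  apply: eq_in_span (in_spanD Hx (in_spanN (first_row x))).
  by case=> [[] z]; rewrite /extend /F /= ?oppr0 ?addr0 ?subrr.
apply: (@eq_in_span _ _ _ _ f _ (in_spanD
  (in_span_trans first_row (in_span_extend false (IH (fun y => f (false, y)))))
  (in_span_trans second_row (in_span_extend true (IH (fun y => f (true, y))))))).
by move=> z; apply/esym/extendE.
Qed.

(** * The two halves of the operator and the action on chains *)

Definition raising n (x y : bcube n) : int :=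
  (n%:R - 2 * (wt x)%:R) * (x == y)%:R + (covers x y)%:R.

Definition low_part m n (x y : bcube n) : int :=
  if (wt x < m)%N then raising x y else 0.

Definition high_part m n (x y : bcube n) : int :=
  if (wt x < m)%N then 0 else raising x y.

Definition chain_step m n (x y : bcube n) : int :=
  if [&& (wt x < m)%N, bot x == bot y & wt y == (wt x).+1]
  then (wt y)%:R - (wt (bot x))%:R else 0.

(** For S = [bot x] and k = [wt x < m] this is h_k(S) A1 = (k+1-|S|) g_(k+1)(S); from level m on
    both sides are 0. *)
Lemma basis_row_low_part m (x z : bcube (2 * m)) : (0 < m)%N ->
  \sum_y basis_row m.-1 x y * low_part m y z =
    \sum_y chain_step m x y * basis_row m y z.
Proof.
move=> m0; have [lt_xm|le_mx] := ltnP (wt x) m; last first.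
  rewrite big1 ?big1 // => y _.
    by rewrite /chain_step ltnNge le_mx mul0r.
  rewrite /basis_row ifN; last by lia.
  by case: eqP => [<-|]; rewrite ?mul0r // /low_part ltnNge le_mx mulr0.
have [lo hi] := wt_bot x.
have [wE bE] : wt (chain (bot x) (wt x).+1) = (wt x).+1 /\
    bot (chain (bot x) (wt x).+1) = bot x by apply: wt_chain; lia.
set x' := chain _ _ in wE bE.
rewrite [RHS](bigD1 x') //= [X in _ + X]big1 ?addr0; last first.
  move=> y neq; rewrite /chain_step; case: and3P; rewrite ?mul0r //.
  case=> _ /eqP E1 /eqP E2; case/eqP: neq; apply: bot_wt_inj; congruence.
rewrite /chain_step lt_xm bE wE !eqxx /=.
have lowE y : basis_row m.-1 x y * low_part m y z =
    (sub (bot x) y)%:R * row_coef m.-1 (wt x) (wt y) * raising y z.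
  rewrite /basis_row ifT; last by lia.
  rewrite /low_part; case: ltnP => // le_my.
  by rewrite row_coef_lt ?mulr0 ?mul0r //; lia.
rewrite (eq_bigr _ (fun y _ => lowE y)) /basis_row wE bE lt_xm.
under eq_bigr => y _ do rewrite /raising mulrDr mulrA.
rewrite big_split /= sum_mul_delta.
(* Every [y] covered by [z] has level [wt z - 1], so the coefficient factors out. *)
rewrite [X in _ + X](_ : _ = \sum_y (sub (bot x) y)%:R * (covers y z)%:R
    * row_coef m.-1 (wt x) (wt z).-1); last first.
  apply: eq_bigr => y _; case: (boolP (covers y z)) => [/covers_wt->|_]; last first.
    by rewrite !mulr0 mul0r.
   by rewrite /= !mulr1.
rewrite -mulr_suml sum_sub_covers.
case: (boolP (sub (bot x) z)) => [/wt_sub le|_]; last by rewrite !(mulr0, mul0r, addr0).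
 by rewrite !mulr1 !mul1r -row_coef_rec // natrM; ring.
Qed.

(** * Transposition combined with complementation *)

(** Complementation negates n - 2|x| and transposes the covers. The sign negates the covers too, so
    that the two halves are exchanged up to an overall minus. *)
Definition signed_compl n (x y : bcube n) : int :=
  (-1) ^+ wt x * (compl x == y)%:R.

Section Conjugation.

Variables (n N : nat) (u : 'I_N -> bcube n).
Hypothesis u_bij : bijective u.

Local Notation mx := (fun_mx u).
Local Notation J := (mx (@signed_compl n)).

Lemma signed_compl_mxK : J *m J^T = 1%:M.
Proof.
rewrite fun_mx_tr fun_mxM // -(fun_mx1 u_bij); apply: eq_fun_mx => x z.
rewrite /signed_compl (eq_bigr (fun y => (-1) ^+ (wt x + wt z) *
  ((compl x == y)%:R * (compl z == y)%:R))) => [|y _]; last by rewrite exprD; ring.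
rewrite -mulr_sumr sum_delta_mul (inj_eq (can_inj (@complK n))) eq_sym.
by case: eqP => [->|]; rewrite ?mulr0 // mulr1 addnn -signr_odd odd_double.
Qed.

Lemma signed_compl_conj (F : bcube n -> bcube n -> int) :
  J *m (mx F)^T *m J^T =
    mx (fun x y => (-1) ^+ (wt x + wt y) * F (compl y) (compl x)).
Proof.
rewrite !fun_mx_tr !fun_mxM //; apply: eq_fun_mx => x y /=.
rewrite (eq_bigr (fun z => (-1) ^+ (wt x + wt y) * F z (compl x) * (compl y == z)%:R)).
  by under eq_bigr => z _ do rewrite eq_sym; rewrite sum_mul_delta.
move=> z _; rewrite /signed_compl.
under eq_bigr => t _ do rewrite -mulrA.
by rewrite -mulr_sumr sum_delta_mul exprD; ring.
Qed.

End Conjugation.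

(** * Reduction of the operator to chain steps *)

Section Diagonalization.

Variables (m : nat).
Hypothesis m_gt0 : (0 < m)%N.
Local Notation n := (2 * m)%N.
Variables (N : nat) (u : 'I_N -> bcube n).
Hypothesis u_bij : bijective u.

Local Notation mx := (fun_mx u).
Local Notation J := (mx (@signed_compl n)).
Local Notation conj A := (J *m A^T *m J^T).

Let conjM (A B : 'M[int]_N) : conj (A *m B) = conj B *m conj A.
Proof.
rewrite trmx_mul !mulmxA -[in RHS](mulmxA _ J^T J).
by rewrite (mulmx1C (signed_compl_mxK u_bij)) mulmx1.
Qed.

(** As n is even, [x] and [compl x] carry the same sign. *)
Let trJ : J^T = J.
Proof.
rewrite fun_mx_tr; apply: eq_fun_mx => x y; rewrite /signed_compl.
have -> : (compl y == x) = (compl x == y).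
  by apply/eqP/eqP => <-; rewrite complK.
case: eqP => [<-|]; rewrite ?mulr0 // wt_compl !mulr1.
by rewrite -signr_odd oddB ?wt_le // oddM /= signr_odd.
Qed.

Let conjK (A : 'M[int]_N) : conj (conj A) = A.
Proof.
have JJ := signed_compl_mxK u_bij; rewrite trJ in JJ.
by rewrite !trmx_mul !trmxK trJ !mulmxA JJ mul1mx -mulmxA JJ mulmx1.
Qed.

Let conjN (A : 'M[int]_N) : conj (- A) = - conj A.
Proof. by rewrite linearN /= mulmxN mulNmx. Qed.

Let conj_unit (A : 'M[int]_N) : A \in unitmx -> conj A \in unitmx.
Proof.
have [uJ uJt] := mulmx1_unit (signed_compl_mxK u_bij).
by move=> uA; rewrite !unitmx_mul uJ uJt unitmx_tr uA.
Qed.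

Local Notation A1 := (mx (@low_part m n)).
Local Notation A2 := (mx (@high_part m n)).
Local Notation F1 := (mx (@chain_step m n)).
Local Notation P1 := (mx (@basis_row m.-1 n)).
Local Notation Q1 := (mx (@basis_row m n)).

Lemma high_part_conj : A2 = - conj A1.
Proof.
rewrite signed_compl_conj //.
apply/matrixP => i j; rewrite !mxE; move: (u i) (u j) => {i j} x y.
have [le_x le_y] := (wt_le x, wt_le y).
rewrite /low_part /high_part /raising wt_compl covers_compl.
rewrite (inj_eq (can_inj (@complK n))) eq_sym natrB //.
have [E|neq] := eqVneq x y.
  rewrite E (_ : covers y y = false); last by apply/negP => /covers_wt; lia.
  rewrite !mulr1 !addr0 addnn -signr_odd odd_double mul1r.
  case: (ltngtP (wt y) m) => H.
  - by rewrite ifN ?oppr0 //; lia.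
  - by rewrite ifT ?natrM; [ring|lia].
  (* Level m is its own complement; its diagonal entry is 0, so both sides agree. *)
  by rewrite ifN; [rewrite H natrM; ring|lia].
rewrite !mulr0 !add0r.
case: (boolP (covers x y)) => [/covers_wt E|_]; last by rewrite !if_same mulr0 oppr0.
rewrite E addnS addnn -signr_odd /= odd_double mulN1r opprK.
by case: ltnP => H; [rewrite ifN // | rewrite ifT //]; lia.
Qed.

Lemma basis_row_high_part : P1 *m A2 = A2.
Proof.
rewrite fun_mxM //; apply: eq_fun_mx => x z.
rewrite -[RHS](sum_delta_mul (fun y => high_part m y z)).
apply: eq_bigr => y _; rewrite /high_part.
case: ltnP => [|le_my]; first by rewrite !mulr0.
rewrite /basis_row; case: leqP => // lt_xm.
rewrite row_coef_lt ?mulr0; last by lia.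
case: eqP => [xy|_]; last by rewrite mul0r.
by move: lt_xm; rewrite xy; lia.
Qed.

Lemma chain_step_conj_basis_row : conj F1 *m Q1 = conj F1.
Proof.
rewrite signed_compl_conj // fun_mxM //; apply: eq_fun_mx => x z.
rewrite -[RHS](sum_mul_delta (fun y => _ * chain_step m (compl y) (compl x))).
apply: eq_bigr => y _; rewrite {1 2}/chain_step.
case: and3P => [[lt_ym _ _]|_]; last by rewrite mulr0 !mul0r.
congr (_ * _); rewrite /basis_row ifN //.
by move: lt_ym; rewrite wt_compl; lia.
Qed.

Lemma mx_raising : mx (@raising n) = A1 + A2.
Proof.
apply/matrixP => i j; rewrite !mxE /low_part /high_part.
by case: ifP; rewrite ?addr0 ?add0r.
Qed.

(** [P1 *m A1 = F1 *m Q1] and its image under [conj], which reverses products, reduce the two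
    halves. The factors for one half act trivially on the other, so the reductions add up. *)
Lemma raising_equiv :
  P1 *m mx (@raising n) *m conj P1 = conj Q1 *m (F1 - conj F1) *m Q1.
Proof.
have E1 : P1 *m A1 = F1 *m Q1.
  by rewrite !fun_mxM //; apply: eq_fun_mx => x z; apply: basis_row_low_part.
have E2 : A2 *m conj P1 = conj Q1 *m - conj F1.
  by rewrite high_part_conj mulNmx -conjM E1 conjM mulmxN.
have E3 : A1 *m conj P1 = A1.
  have A1E : A1 = - conj A2 by rewrite high_part_conj conjN conjK opprK.
  by rewrite A1E mulNmx -conjM basis_row_high_part.
have E4 : conj Q1 *m F1 = F1.
  by rewrite -{1}(conjK F1) -conjM chain_step_conj_basis_row conjK.
rewrite mx_raising mulmxDr mulmxDl basis_row_high_part -mulmxA E3 E1 E2.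
rewrite mulmxDr E4 mulmxDl; congr (_ + _).
by rewrite -[RHS]mulmxA mulNmx chain_step_conj_basis_row.
Qed.

End Diagonalization.

(** * The monomial form and its entries *)

Definition height n (x : bcube n) := (wt x - wt (bot x))%N.

Definition diag_val m (x : bcube (2 * m)) : nat :=
  if (wt x < m)%N then (height x).+1 else height (compl x).

(** Column of the only possible nonzero entry of row [x] in F1 - conj F1. If [compl x] is a bottom
    the row is 0, and it is assigned a column that no nonzero row uses. *)
Definition diag_perm m (x : bcube (2 * m)) : bcube (2 * m) :=
  if (wt x < m)%N then chain (bot x) (wt x).+1
  else let r := compl x in
    if height r == 0%N then r else compl (chain (bot r) (wt r).-1).

Lemma wt_compl_half m (x : bcube (2 * m)) :
  (m <= wt x)%N -> (wt (compl x) <= m)%N.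
Proof. by rewrite wt_compl; lia. Qed.

Lemma chain_up m (x : bcube (2 * m)) : (wt x < m)%N ->
  wt (chain (bot x) (wt x).+1) = (wt x).+1 /\
  bot (chain (bot x) (wt x).+1) = bot x.
Proof. by have [lo hi] := wt_bot x => lt; apply: wt_chain; lia. Qed.

Lemma chain_down n (x : bcube n) : height x != 0%N ->
  wt (chain (bot x) (wt x).-1) = (wt x).-1 /\
  bot (chain (bot x) (wt x).-1) = bot x.
Proof. by rewrite /height => h; have [lo hi] := wt_bot x; apply: wt_chain; lia. Qed.

(** The three cases have disjoint images: non-bottoms of level at most m, bottoms, and elements
    above level m. *)
Lemma diag_perm_inj m : injective (@diag_perm m).
Proof.
move=> x y; rewrite /diag_perm.
have cinj := can_inj (@complK (2 * m)).
have up_down (z t : bcube (2 * m)) : (wt z < m)%N -> (m <= wt t)%N ->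
    chain (bot z) (wt z).+1 <>
    if height (compl t) == 0%N then compl t
    else compl (chain (bot (compl t)) (wt (compl t)).-1).
  move=> lt_zm le_mt; have [wE bE] := chain_up lt_zm.
  have [lo hi] := wt_bot z; have rm := wt_compl_half le_mt.
  case: eqP => [h0 E|/eqP h].
    by move: h0; rewrite -E /height wE bE; lia.
  have [wE' _] := chain_down h.
  move=> /(congr1 (@wt _)); rewrite wt_compl wE wE'.
  by move: h; rewrite /height; lia.
case: (ltnP (wt x) m) => Hx; case: (ltnP (wt y) m) => Hy /=.
- have [wx bx] := chain_up Hx; have [wy by_] := chain_up Hy.
  by move=> E; apply: bot_wt_inj; [rewrite -bx E | apply: succn_inj; rewrite -wx E].
- by move=> E; case: (up_down x y Hx Hy).
- by move=> E; case: (up_down y x Hy Hx).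
have rx := wt_compl_half Hx; have ry := wt_compl_half Hy.
case: eqP => [hx|/eqP hx]; case: eqP => [hy|/eqP hy].
- exact: cinj.
- have [wE bE] := chain_down hy.
  move=> /(congr1 (@wt _)); rewrite [in RHS]wt_compl wE.
  by move: hy; rewrite /height; lia.
- have [wE bE] := chain_down hx.
  move=> /(congr1 (@wt _)); rewrite [in LHS]wt_compl wE.
  by move: hx; rewrite /height; lia.
have [wx bx] := chain_down hx; have [wy by_] := chain_down hy.
move=> /cinj E; apply: cinj; apply: bot_wt_inj; first by rewrite -bx E.
by have := congr1 (@wt _) E; rewrite wx wy; move: hx hy; rewrite /height; lia.
Qed.

Lemma step_sum_monomial m (x y : bcube (2 * m)) :
  chain_step m x y - (-1) ^+ (wt x + wt y) * chain_step m (compl y) (compl x)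
    = (diag_val x)%:R * (diag_perm x == y)%:R.
Proof.
have [lox hix] := wt_bot x; have [le_x le_y] := (wt_le x, wt_le y).
rewrite /chain_step /diag_val /diag_perm; case: (ltnP (wt x) m) => Hx /=.
  rewrite [X in _ * X]ifN ?mulr0 ?subr0; last first.
    by apply/negP => /and3P[+ _ /eqP]; rewrite !wt_compl; lia.
  have [wE bE] := chain_up Hx.
  have -> : (chain (bot x) (wt x).+1 == y) = (bot x == bot y) && (wt y == (wt x).+1).
    apply/eqP/andP => [<-|[/eqP E1 /eqP E2]]; first by rewrite bE wE !eqxx.
    by rewrite E1 -E2 chain_bot.
  case: andP => [[/eqP E1 /eqP E2]|]; last by rewrite mulr0.
  by rewrite mulr1 E2 -natrB ?/height ?subSn //; lia.
have rm := wt_compl_half Hx; rewrite add0r.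
have [lo hi] := wt_bot (compl x).
case: and3P => [[lt_y /eqP Eb /eqP Ew]|not_step]; last first.
  rewrite mulr0 oppr0; case: (eqVneq (height (compl x)) 0%N) => [->|h].
    by rewrite mul0r.
  case: eqP => [E|]; last by rewrite mulr0.
  have [wE bE] := chain_down h; case: not_step.
  rewrite -E complK wE bE eqxx; move: h; rewrite /height => h.
  by split=> //; lia.
have wy : wt y = (wt x).+1 by move: Ew; rewrite !wt_compl; lia.
(* Consecutive levels give the sign -1, which cancels the minus in front. *)
rewrite wy addnS addnn -signr_odd /= odd_double mulN1r opprK.
rewrite Eb /height -natrB // -/(height _).
case: (eqVneq (height (compl x)) 0%N) => [->|h]; first by rewrite !mul0r.
rewrite -Eb Ew /= chain_bot complK eqxx mulr1 //.
Qed.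

(** * Assembly of the unimodular factors *)

Lemma fun_mx_perm (X : finType) (N : nat) (u : 'I_N -> X) (s : X -> X) :
  bijective u -> injective s ->
  fun_mx u (fun x y => (s x == y)%:R) \in unitmx.
Proof.
move=> u_bij s_inj.
suff /mulmx1_unit[] : fun_mx u (fun x y => (s x == y)%:R) *m
   (fun_mx u (fun x y => (s x == y)%:R))^T = 1%:M by [].
rewrite fun_mx_tr fun_mxM // -(fun_mx1 u_bij); apply: eq_fun_mx => x y.
by rewrite sum_delta_mul (inj_eq s_inj) eq_sym.
Qed.

Lemma adj_equiv m (N : nat) (u : 'I_N -> bcube (2 * m)) :
  (0 < m)%N -> bijective u ->
  integrally_equivalent (fun_mx u (fun x y => (adj x y)%:R))
    (diag_mx (\row_i (diag_val (u i))%:R)).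
Proof.
move=> m0 u_bij; set A := fun_mx u _; set D := diag_mx _.
pose Z : 'M[int]_N := fun_mx u (fun x y => (sub y x)%:R).
pose S : 'M[int]_N := fun_mx u (fun x y => (diag_perm x == y)%:R).
pose P := fun_mx u (@basis_row m.-1 (2 * m)).
pose Q := fun_mx u (@basis_row m (2 * m)).
pose J := fun_mx u (@signed_compl (2 * m)).
have uZ : Z \in unitmx by apply: fun_mx_unit => // y; apply: sub_row_span.
have uP : P \in unitmx by apply: fun_mx_unit => // y; apply: basis_row_span.
have uQ : Q \in unitmx by apply: fun_mx_unit => // y; apply: basis_row_span.
have uS : S \in unitmx by apply: fun_mx_perm => //; apply: diag_perm_inj.
have [uJ uJt] := mulmx1_unit (signed_compl_mxK u_bij).
have AZ : A *m Z = Z *m fun_mx u (@raising (2 * m)).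
  rewrite !fun_mxM //; apply: eq_fun_mx => z s; rewrite sum_adj_sub /raising.
  under [in RHS]eq_bigr => y _ do rewrite mulrDr mulrA.
  by rewrite big_split /= sum_mul_delta mulrC.
have step_sum : fun_mx u (@chain_step m (2 * m))
    - J *m (fun_mx u (@chain_step m (2 * m)))^T *m J^T = D *m S.
  rewrite signed_compl_conj //; apply/matrixP => i j.
  by rewrite mul_diag_mx !mxE step_sum_monomial.
have main := raising_equiv m0 u_bij; rewrite step_sum in main.
pose P' := J *m P^T *m J^T; pose Q' := J *m Q^T *m J^T.
have uP' : P' \in unitmx by rewrite !unitmx_mul uJ unitmx_tr uP uJt.
have uQ' : Q' \in unitmx by rewrite !unitmx_mul uJ unitmx_tr uQ uJt.
rewrite -/P -/Q -/J -/P' -/Q' in main; clearbody P' Q' P Q S Z.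
(* Obtained by solving P (Z^-1 A Z) P' = Q' D S Q for D. *)
exists (invmx Q' *m P *m invmx Z), (Z *m P' *m invmx Q *m invmx S); split.
- by rewrite !unitmx_mul !unitmx_inv uQ' uP uZ.
- by rewrite !unitmx_mul !unitmx_inv uZ uP' uQ uS.
rewrite !mulmxA -(mulmxA _ A Z) AZ !mulmxA mulmxKV //.
rewrite -2!(mulmxA (invmx Q')) [P *m _ *m _]main !mulmxA.
by rewrite mulVmx // mul1mx mulmxK // mulmxK.
Qed.

(** * Multiplicities of the diagonal values *)

Lemma card_wt n c : #|[set x : bcube n | wt x == c]| = 'C(n, c).
Proof.
suff H : \sum_(x : bcube n) (wt x == c)%:R = ('C(n, c))%:R :> int.
  apply/eqP; rewrite -eqz_nat -!natz -H -sum1_card natr_sum big_mkcond /=.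
  by apply/eqP/eq_bigr => x _; rewrite inE; case: eqP.
elim: n c => [|n IH] c.
  rewrite (eq_bigr (fun=> (c == 0%N)%:R)) => [|x _]; last by rewrite /= eq_sym.
  by rewrite sumr_const card_unit bin0n.
rewrite bcube_sum IH; case: c => [|c] /=; last by rewrite IH binS natrD.
by rewrite big1 // !bin0 addr0.
Qed.

Lemma eq_card_can (X Y : finType) (A : {set X}) (B : {set Y}) (f : X -> Y) (g : Y -> X) :
  (forall x, x \in A -> f x \in B /\ g (f x) = x) ->
  (forall y, y \in B -> g y \in A /\ f (g y) = y) -> #|A| = #|B|.
Proof.
move=> Hf Hg; rewrite -(card_in_imset (can_in_inj (fun x Ax => (Hf x Ax).2))).
apply: eq_card => y; apply/imsetP/idP => [[x /Hf[fx _] ->] //|/Hg[gy <-]].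
by exists (g y); rewrite // (Hg _ _).2.
Qed.

(* Each chain with bottom of weight at most [c] meets level [c] exactly once. *)
Lemma card_height n c j : (2 * c + j <= n)%N ->
  #|[set x : bcube n | (height x == j) && (wt (bot x) <= c)%N]| = 'C(n, c).
Proof.
move=> le_n; rewrite -card_wt.
apply: (@eq_card_can _ _ _ _ (fun x => chain (bot x) c)
  (fun y => chain (bot y) (wt (bot y) + j))) => x; rewrite !inE.
  rewrite /height => /andP[/eqP hx le_c]; have [lo hi] := wt_bot x.
  have [wE bE] : wt (chain (bot x) c) = c /\ bot (chain (bot x) c) = bot x.
    by apply: wt_chain; lia.
  rewrite wE bE eqxx; split=> //.
  by rewrite (_ : (_ + j)%N = wt x) ?chain_bot //; lia.
move=> /eqP wx; have [lo hi] := wt_bot x.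
have [wE bE] : wt (chain (bot x) (wt (bot x) + j)) = (wt (bot x) + j)%N /\
    bot (chain (bot x) (wt (bot x) + j)) = bot x by apply: wt_chain; lia.
rewrite /height bE wE; split; first by apply/andP; split; lia.
by rewrite -[RHS]chain_bot wx.
Qed.

(** At height k-1, [wt x < m] means [wt (bot x) <= m - k]. *)
Lemma card_low m k : (0 < k <= m)%N ->
  #|[set x : bcube (2 * m) | (wt x < m)%N && ((height x).+1 == k)]|
    = 'C(2 * m, m - k).
Proof.
move=> km; rewrite -(@card_height _ _ k.-1); last by lia.
apply: eq_card => x; rewrite !inE; have [lo hi] := wt_bot x.
by rewrite /height; lia.
Qed.

Lemma card_high m k : (k <= m)%N ->
  #|[set x : bcube (2 * m) | (m <= wt x)%N && (height (compl x) == k)]|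
    = 'C(2 * m, m - k).
Proof.
move=> km; rewrite -(@card_height _ _ k); last by lia.
apply: (@eq_card_can _ _ _ _ (@compl _) (@compl _)) => x; rewrite !inE !complK => H;
  split=> //; move: H; rewrite /height; have [lo hi] := wt_bot (compl x);
  have [lo' hi'] := wt_bot x; have := wt_le x; rewrite !wt_compl in lo hi *; lia.
Qed.

(** Rows below level m have values at least 1, so 0 comes only from the other rows; a positive value
    comes equally often from both. *)
Lemma card_diag_val m k : (k <= m)%N ->
  #|[set x : bcube (2 * m) | diag_val x == k]|
    = ((if k == 0 then 1 else 2) * 'C(2 * m, m - k))%N.
Proof.
move=> km; pose L := [set x : bcube (2 * m) | (wt x < m)%N].
rewrite -(cardsID L).
rewrite (_ : _ :&: L = [set x | (wt x < m)%N && ((height x).+1 == k)]); last first.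
  by apply/setP => x; rewrite !inE /diag_val andbC; case: ltnP.
rewrite (_ : _ :\: L = [set x | (m <= wt x)%N && (height (compl x) == k)]); last first.
  by apply/setP => x; rewrite !inE /diag_val; case: ltnP.
rewrite card_high //; case: eqVneq => [->|k0].
  rewrite mul1n (_ : [set x | _] = set0) ?cards0 //.
  by apply/setP => x; rewrite !inE andbF.
by rewrite card_low ?mul2n ?addnn // lt0n k0.
Qed.

Lemma diag_val_le m (x : bcube (2 * m)) : (diag_val x <= m)%N.
Proof.
rewrite /diag_val /height; case: ltnP => [|/wt_compl_half]; lia.
Qed.

(** * Transfer to the cube graph *)

Fixpoint to_bcube n : cube_vertex n -> bcube n :=
  if n is n'.+1 return cube_vertex n -> bcube n then
    fun x => (x ord0, to_bcube [ffun i => x (lift ord0 i)])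
  else fun=> tt.

Lemma to_bcube_inj n : injective (@to_bcube n).
Proof.
elim: n => [|n IH] x y /=; first by move=> _; apply/ffunP => -[].
case=> E0 /IH E; apply/ffunP => i; case: (unliftP ord0 i) => [j ->|-> //].
by have := congr1 (fun f : {ffun _} => f j) E; rewrite !ffunE.
Qed.

Lemma to_bcube_bij n : bijective (@to_bcube n).
Proof.
apply: (inj_card_bij (@to_bcube_inj n)).
rewrite card_ffun card_bool card_ord.
by elim: n => [|n IH]; rewrite ?card_unit //= card_prod card_bool expnS leq_mul2l IH.
Qed.

(** Both relations say that the Hamming distance is 1, and this distance splits along the first
    coordinate just as [adj] does. *)
Lemma adj_to_bcube n (x y : cube_vertex n) :
  adj (to_bcube x) (to_bcube y) = cube_adj x y.
Proof.
pose dist k (x y : cube_vertex k) := #|[set i | x i != y i]|.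
have dist0 k (s t : cube_vertex k) : (dist k s t == 0%N) = (s == t).
  rewrite cards_eq0; apply/eqP/eqP => [E|->].
    apply/ffunP => i; have := congr1 (fun A : {set _} => i \in A) E.
    by rewrite !inE => /negPn/eqP.
  by apply/setP => i; rewrite !inE eqxx.
rewrite -[cube_adj x y]/(dist n x y == 1%N).
elim: n x y => [|n IH] x y.
  rewrite /dist; have := max_card [set i | x i != y i].
  by rewrite card_ord leqn0 => /eqP->.
have distS : dist n.+1 x y = ((x ord0 != y ord0) +
    dist n [ffun i => x (lift ord0 i)] [ffun i => y (lift ord0 i)])%N.
  have distE k (s t : cube_vertex k) : dist k s t = (\sum_i (s i != t i))%N.
    by rewrite /dist -sum1_card big_mkcond; apply: eq_bigr => i _; rewrite inE; case: eqP.
  rewrite !distE big_ord_recl; congr (_ + _)%N.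
  by apply: eq_bigr => i _; rewrite !ffunE.
rewrite distS /= IH (inj_eq (@to_bcube_inj n)) -dist0.
by case: eqP.
Qed.

Theorem theorem1p1 (m n : nat) (hm : (1 <= m)%N) (hn : n = (2 * m)%N)
    (v : 'I_(2 ^ n) -> cube_vertex n) (hv : bijective v) :
  exists d : 'rV[int]_(2 ^ n),
    [/\ integrally_equivalent (adjacency_mx (@cube_adj n) v) (diag_mx d),
        #|[set i | d 0 i == 0]| = 'C(n, m),
        (forall i, d 0 i != 0 ->
           exists2 k : nat, (1 <= k <= m)%N & d 0 i = k%:Z)
      & (forall k : nat, (1 <= k <= m)%N ->
           #|[set i | d 0 i == k%:Z]| = (2 * 'C(n, m - k))%N)].
Proof.
subst n; pose u i := to_bcube (v i).
have u_bij : bijective u := bij_comp (to_bcube_bij _) hv.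
pose d := \row_i (diag_val (u i))%:R : 'rV[int]_(2 ^ (2 * m)).
have dE i : d 0 i = (diag_val (u i))%:Z by rewrite mxE natz.
have card_d k : (k <= m)%N -> #|[set i | d 0 i == k%:Z]| =
    ((if k == 0 then 1 else 2) * 'C(2 * m, m - k))%N.
  move=> km; rewrite -card_diag_val // -(on_card_preimset (onW_bij _ u_bij)).
  by apply: eq_card => i; rewrite !inE dE eqz_nat.
exists d; split.
- rewrite (_ : adjacency_mx _ _ = fun_mx u (fun x y => (adj x y)%:R)).
    exact: adj_equiv.
  by apply/matrixP => i j; rewrite !mxE adj_to_bcube.
- by have := card_d 0%N (leq0n m); rewrite mul1n subn0.
- move=> i; rewrite dE => nz; exists (diag_val (u i)) => //.
  by rewrite diag_val_le andbT lt0n.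
by move=> k /andP[k0 km]; rewrite card_d // eqn0Ngt k0.
Qed.
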